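(* Let $R$ be an integral domain with fraction field $K$. Let $W=\bigcup_{n\ge0}W_n\subseteq R$, where $W_0=\{1\}$, $V_0=U(R)$, and inductively for $i\ge1$, $W_i$ is the set of nonzero finite sums of elements of $V_{i-1}$ and $V_i=\widetilde{W_i}$ is the saturation of $W_i$. Then $R^{\mathrm{ua}}=W^{-1}R$ (as subrings of $K$), where $R^{\mathrm{ua}}$ is the unit-additive closure of $R$ in $K$.
   Context: All rings are commutative and unital. $U(R)$ is the group of units of $R$. A ring $R$ is unit-additive if whenever $u,v$ are units of $R$, $u+v$ is either a unit of $R$ or a nilpotent element. The saturation of a multiplicative set $W\subseteq R$ is $\widetilde W=\{x\in R\mid \exists y\in R,\ xy\in W\}$; each $W_i$ in the claim is multiplicatively closed. The unit-additive closure $R^{\mathrm{ua}}$ of a domain $R$ is the intersection of all unit-additive subrings of its fraction field $K$ that contain $R$. *)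

(* Defs.v *)
From mathcomp Require Import all_boot all_order all_algebra.
From mathcomp Require Import boolp classical_sets.
Set Implicit Arguments.
Unset Strict Implicit.
Unset Printing Implicit Defensive.
Import GRing.Theory.
Local Open Scope classical_set_scope.
Local Open Scope ring_scope.

(* Subrings of a ring A are possibly undecidable subsets of A, hence
   [S : set A]; units, nilpotents and unit-additivity of the ring S are
   expressed inside A (for S = setT they are those of A itself). *)
Section Subrings.
Variable A : comNzRingType.
Implicit Types S : set A.

Definition is_subring S : Prop := GRing.subring_closed (mem S).

Definition units_of S : set A :=
  [set u | S u /\ exists2 v, S v & u * v = 1].

Definition nilpotents_of S : set A :=
  [set x | S x /\ exists n : nat, x ^+ n = 0].

Definition unit_additive S : Prop :=
  forall u v, units_of S u -> units_of S v ->
    units_of S (u + v) \/ nilpotents_of S (u + v).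

Definition saturation (W : set A) : set A := [set x | exists y, W (x * y)].

Definition nonzero_sums (V : set A) : set A :=
  [set x | x != 0 /\
    exists2 s : seq A, (forall y, y \in s -> V y) & x = \sum_(y <- s) y].

End Subrings.

Section UnitAdditiveClosure.
Variable R : idomainType.
Local Notation K := {fraction R}.

Definition embed : R -> K := @FracField.tofrac R.

Definition ua_closure : set K :=
  \bigcap_(S in [set S : set K |
    [/\ is_subring S, unit_additive S & range embed `<=` S]]) S.

Fixpoint ua_V (n : nat) : set R :=
  if n is m.+1 then saturation (nonzero_sums (ua_V m))
  else [set x | x \is a GRing.unit].

Definition ua_W (n : nat) : set R :=
  if n is m.+1 then nonzero_sums (ua_V m) else [set 1].

(* W^{-1}R inside K, for a multiplicative set W of nonzero elements. *)
Definition localization (W : set R) : set K :=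
  [set x | exists r w, W w /\ x = embed r / embed w].

End UnitAdditiveClosure.

Arguments ua_closure R : clear implicits.
Arguments ua_V R n : clear implicits.
Arguments ua_W R n : clear implicits.

(* Main.v *)
Require Import Defs.
From mathcomp Require Import all_boot all_order all_algebra.
From mathcomp Require Import boolp classical_sets.
Local Open Scope classical_set_scope.

(* The sets W_n increase and each is multiplicatively closed. A unit of W^-1 R
   is a fraction whose numerator lies in some V_n, and so after reduction to a
   common denominator the sum of two units has a numerator which is a sum of two
   elements of V_n: it is 0 or in W_(n+1). Conversely, in a unit-additive
   subring S of K containing R, nonzero sums of units are units because K is
   reduced, and divisors of units are units; by induction every V_n and W_n
   consists of units of S, hence W^-1 R is contained in S. *)

Set Implicit Arguments.
Unset Strict Implicit.
Unset Printing Implicit Defensive.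
Import GRing.Theory.
Local Open Scope ring_scope.

Definition mul_closed (A : comNzRingType) (W : set A) : Prop :=
  forall x y, W x -> W y -> W (x * y).

Section Tower.
Variable R : idomainType.
Implicit Types (V W : set R) (x y : R).

(** Distributivity turns a product of two sums into the sum of all pairwise products. *)
Lemma nonzero_sums_mul V : mul_closed V -> mul_closed (nonzero_sums V).
Proof.
move=> VM x y [x0 [s sV xE]] [y0 [t tV yE]]; split; first by rewrite mulf_neq0.
exists [seq a * b | a <- s, b <- t].
  by move=> z /allpairsP[[a b] /= [/sV Va /tV Vb ->]]; exact: VM.
by rewrite big_allpairs_dep xE yE big_distrl /=; apply: eq_bigr => a _; rewrite big_distrr.
Qed.

Lemma saturation_mul W : mul_closed W -> mul_closed (saturation W).
Proof.
move=> WM x y [x' Wx] [y' Wy]; exists (x' * y').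
by rewrite mulrACA; exact: WM.
Qed.

Lemma ua_V_mul n : mul_closed (ua_V R n).
Proof.
elim: n => [|n IHn] /=; first by move=> x y /= xU yU; rewrite unitrM xU.
exact/saturation_mul/nonzero_sums_mul.
Qed.

Lemma ua_W_mul n : mul_closed (ua_W R n).
Proof.
case: n => [|n] /=; first by move=> x y /= -> ->; rewrite mulr1.
exact/nonzero_sums_mul/ua_V_mul.
Qed.

Lemma ua_W_neq0 n x : ua_W R n x -> x != 0.
Proof. by case: n => [/= ->|n []//]; exact: oner_neq0. Qed.

Lemma ua_V_neq0 n x : ua_V R n x -> x != 0.
Proof.
case: n => [|n] /=; first by apply: contraTneq => ->; rewrite unitr0.
by move=> [y [xy0 _]]; apply: contraNneq xy0 => ->; rewrite mul0r.
Qed.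

Lemma ua_W_subV n : ua_W R n `<=` ua_V R n.
Proof.
case: n => [|n] x /=; first by move=> ->; exact: unitr1.
by move=> Wx; exists 1; rewrite mulr1.
Qed.

Lemma ua_V_subW n : ua_V R n `<=` ua_W R n.+1.
Proof.
move=> x Vx; split; first exact: ua_V_neq0 Vx.
by exists [:: x]; [move=> y /[1!inE] /eqP -> | rewrite big_seq1].
Qed.

(** The two towers interleave: $W_n \subseteq V_n \subseteq W_{n+1}$. *)
Lemma ua_W_le m n : (m <= n)%N -> ua_W R m `<=` ua_W R n.
Proof.
move=> /subnK <-; elim: (n - m)%N => [//|k IHk] x /IHk.
by move=> /ua_W_subV /ua_V_subW.
Qed.

(** For positive [n] this is the definition of [ua_V]; for [n = 0] it holds because the divisors of
    1 are exactly the units. *)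
Lemma ua_W_saturation n : saturation (ua_W R n) `<=` ua_V R n.
Proof.
case: n => [|n] x //= [y xy1].
by apply/unitrP; exists y; rewrite mulrC xy1.
Qed.

Lemma bigcup_ua_W_mul : mul_closed (\bigcup_n ua_W R n).
Proof.
move=> x y [m _ Wx] [n _ Wy]; exists (maxn m n) => //.
by apply: ua_W_mul; [exact: ua_W_le (leq_maxl _ _) _ _
                    |exact: ua_W_le (leq_maxr _ _) _ _].
Qed.

Lemma bigcup_ua_W_neq0 x : (\bigcup_n ua_W R n) x -> x != 0.
Proof. by move=> [n _ /ua_W_neq0]. Qed.

Lemma bigcup_ua_W1 : (\bigcup_n ua_W R n) 1.
Proof. by exists 0%N. Qed.

Lemma saturation_bigcup_ua_WD x y :
  saturation (\bigcup_n ua_W R n) x -> saturation (\bigcup_n ua_W R n) y ->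
  x + y != 0 -> (\bigcup_n ua_W R n) (x + y).
Proof.
(* Both summands lie in $V_N$ for $N = \max(m, n)$, and sums of elements of $V_N$ appear one level
   up. *)
move=> [x' [m _ Wx]] [y' [n _ Wy]] xy0; exists (maxn m n).+1 => //.
split=> //; exists [:: x; y]; last by rewrite big_cons big_seq1.
move=> z /[!inE] /orP[] /eqP ->; apply: ua_W_saturation.
  by exists x'; exact: ua_W_le (leq_maxl _ _) _ _.
by exists y'; exact: ua_W_le (leq_maxr _ _) _ _.
Qed.

End Tower.

Section Embed.
Variable R : idomainType.
Local Notation embed := (@embed R).

Lemma embed1 : embed 1 = 1. Proof. exact: rmorph1. Qed.
Lemma embedD : {morph embed : x y / x + y}. Proof. exact: rmorphD. Qed.
Lemma embedB : {morph embed : x y / x - y}. Proof. exact: rmorphB. Qed.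
Lemma embedM : {morph embed : x y / x * y}. Proof. exact: rmorphM. Qed.
Lemma embed_eq0 x : (embed x == 0) = (x == 0).
Proof. exact: tofrac_eq0. Qed.
Lemma embed_inj : injective embed.
Proof. by move=> x y /eqP; rewrite -subr_eq0 -embedB embed_eq0 subr_eq0 => /eqP. Qed.

End Embed.

Section Localization.
Variables (R : idomainType) (W : set R).
Hypotheses (W1 : W 1) (WM : mul_closed W) (W0 : forall x, W x -> x != 0).
Local Notation K := {fraction R}.

Let embedW0 w : W w -> embed w != 0.
Proof. by rewrite embed_eq0; exact: W0. Qed.

Lemma localization_embed : range (@embed R) `<=` localization W.
Proof. by move=> _ [r _ <-]; exists r, 1; rewrite embed1 divr1. Qed.

Lemma localization_subring : is_subring (localization W).
Proof.
split.
- by apply/mem_set/localization_embed; exists 1 => //; exact: embed1.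
- move=> _ _ /set_mem[a [w [Ww ->]]] /set_mem[b [v [Wv ->]]]; apply/mem_set.
  exists (a * v - b * w), (w * v); split; first exact: WM.
  by rewrite embedB !embedM -mulNr addf_div ?embedW0// mulNr.
- move=> _ _ /set_mem[a [w [Ww ->]]] /set_mem[b [v [Wv ->]]]; apply/mem_set.
  exists (a * b), (w * v); split; first exact: WM.
  by rewrite !embedM mulf_div.
Qed.

(** If $(a/w)(b/v) = 1$ then $ab = wv \in W$, so [b] witnesses that [a] is in the saturation. *)
Lemma localization_unit u : units_of (localization W) u ->
  exists a w, [/\ saturation W a, W w & u = embed a / embed w].
Proof.
move=> [[a [w [Ww ->]]] [_ [b [v [Wv ->]]] uv1]]; exists a, w; split=> //.
exists b; suff -> : a * b = w * v by exact: WM.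
apply: embed_inj; rewrite !embedM; apply/divr1_eq.
by rewrite -mulf_div.
Qed.

Lemma localization_unit_additive :
  (forall x y, saturation W x -> saturation W y -> x + y != 0 -> W (x + y)) ->
  unit_additive (localization W).
Proof.
move=> WD u1 u2 /localization_unit[a [w [Wa Ww ->]]].
move=> /localization_unit[b [v [Wb Wv ->]]].
rewrite addf_div ?embedW0// -!embedM -embedD.
(* Cross-multiplying by the denominators keeps both numerators in the saturation, so [WD] applies to
   their sum. *)
have satM x y : saturation W x -> W y -> saturation W (x * y).
  by move=> [z Wz] Wy; exists z; rewrite mulrAC; exact: WM.
have Wwv : W (w * v) by exact: WM.
have [->|cN0] := eqVneq (a * v + b * w) 0.
  right; rewrite /embed rmorph0 mul0r; split; last by exists 1%N; rewrite expr1.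
  by exists 0, 1; split=> //; rewrite /embed rmorph0 mul0r.
have Wc := WD _ _ (satM _ _ Wa Wv) (satM _ _ Wb Ww) cN0.
left; split; first by exists (a * v + b * w), (w * v).
(* The numerator is in [W] itself, so the swapped fraction is again in the localization. *)
exists (embed (w * v) / embed (a * v + b * w)).
  by exists (w * v), (a * v + b * w).
by rewrite mulf_div [X in _ / X]mulrC mulfV ?mulf_neq0 ?embedW0.
Qed.

End Localization.

Section UnitAdditiveSubring.
Variables (R : idomainType) (S : set {fraction R}).
Hypotheses (ringS : is_subring S) (uaS : unit_additive S).
Hypothesis RS : range (@embed R) `<=` S.

Lemma subring_mul : mul_closed S.
Proof.
case: ringS => _ _ SM x y Sx Sy.
by apply/set_mem; apply: SM; exact/mem_set.
Qed.

Lemma embedS x : S (embed x). Proof. by apply: RS; exists x. Qed.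

(** The alternative 0 is carried through the induction because a partial sum may vanish even when
    the whole sum does not. *)
Lemma units_of_sum (s : seq {fraction R}) : (forall y, y \in s -> units_of S y) ->
  \sum_(y <- s) y = 0 \/ units_of S (\sum_(y <- s) y).
Proof.
elim: s => [_|a s IHs sU]; first by left; rewrite big_nil.
have aU : units_of S a by apply: sU; rewrite mem_head.
rewrite big_cons; case: IHs => [y ys|->|suU].
- by apply: sU; rewrite inE ys orbT.
- by rewrite addr0; right.
- case: (uaS aU suU) => [|[_ [n /eqP]]]; first by right.
  (* A nilpotent element of a field is 0. *)
  by rewrite expf_eq0 => /andP[_ /eqP]; left.
Qed.

Lemma embed_nonzero_sums (V : set R) :
  (forall x, V x -> units_of S (embed x)) ->
  forall x, nonzero_sums V x -> units_of S (embed x).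
Proof.
move=> VU x [x0 [s sV xE]].
have xE' : embed x = \sum_(y <- map (@embed R) s) y.
  by rewrite big_map xE /embed rmorph_sum.
have [y /mapP[z /sV /VU zU ->]//|/eqP|] := @units_of_sum (map (@embed R) s).
  by rewrite -xE' embed_eq0 (negPf x0).
by rewrite -xE'.
Qed.

(** If [z] inverts [x * y] in [S], then [y * z] inverts [x], and it stays in [S] since [S] contains
    [R]. *)
Lemma embed_saturation (W : set R) :
  (forall x, W x -> units_of S (embed x)) ->
  forall x, saturation W x -> units_of S (embed x).
Proof.
move=> WU x [y /WU[_ [z Sz xyz]]]; split; first exact: embedS.
exists (embed y * z); first exact: subring_mul (embedS y) Sz.
by rewrite mulrA -embedM.
Qed.

Lemma embed_ua_V n x : ua_V R n x -> units_of S (embed x).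
Proof.
elim: n x => [x /= xU|n IHn]; last exact/embed_saturation/embed_nonzero_sums.
split; first exact: embedS.
by exists (embed x^-1); [exact: embedS | rewrite -embedM mulrV// embed1].
Qed.

Lemma localization_ua_W_sub : localization (\bigcup_n ua_W R n) `<=` S.
Proof.
move=> _ [r [w [[n _ /ua_W_subV /embed_ua_V [_ [v Sv wv1]]]] ->]].
have w0 : embed w != 0.
  by apply: contra_eq_neq wv1 => ->; rewrite mul0r eq_sym oner_neq0.
(* Inverses in the field are unique, so the inverse of [w] in $K$ is the one already found in
   [S]. *)
suff -> : (embed w)^-1 = v by exact: subring_mul (embedS r) Sv.
by apply: (mulfI w0); rewrite mulfV.
Qed.

End UnitAdditiveSubring.

Local Close Scope ring_scope.
Unset Implicit Arguments.

Theorem proposition8p4 (R : idomainType) :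
  ua_closure R = localization (\bigcup_n ua_W R n).
Proof.
have W1 := @bigcup_ua_W1 R; have WM := @bigcup_ua_W_mul R.
have W0 := @bigcup_ua_W_neq0 R.
apply/seteqP; split=> [x|x Wx S [ringS uaS RS]].
  (* The localization is itself one of the subrings being intersected, so it contains the
     intersection. *)
  apply; split; first exact: localization_subring.
    exact: localization_unit_additive (@saturation_bigcup_ua_WD R).
  exact: localization_embed.
exact: localization_ua_W_sub Wx.
Qed.
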